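(* Let $\Omega$ be a finite set, let $G$ be a primitive permutation group on $\Omega$ and let $f:\Omega\to\Omega$ be a map. If $f$ has kernel type $(p,2,1,\ldots,1)$ with $p\geq 2$, then $G$ synchronises $f$, i.e. the semigroup $\langle G,f\rangle$ generated by $G$ and $f$ (under composition of maps) contains a constant map.
   Context: The kernel of a map $f:\Omega\to\Omega$ is the partition of $\Omega$ into the preimages $f^{-1}(y)$ of points $y$ in the image of $f$; its kernel type is the partition of the integer $|\Omega|$ formed by the sizes of the parts of the kernel. Kernel type $(p,2,1,\ldots,1)$ means one part of size $p$, one part of size $2$, and all other parts of size $1$. A permutation group on $\Omega$ is primitive if it preserves no nontrivial partition of $\Omega$. *)

(* Defs.v *)
From mathcomp Require Import all_boot all_fingroup all_solvable.

Set Implicit Arguments.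
Unset Strict Implicit.
Unset Printing Implicit Defensive.

Local Open Scope group_scope.

(* The library's [primitive G, on [set: T] | 'P] additionally requires G to be
   transitive. For #|T| > 2 this is automatic (primitive_groupE below); the two
   notions differ only for the trivial group on at most two points. *)
Definition primitive_group (T : finType) (G : {group {perm T}}) : bool :=
  ~~ [exists Q : {set {set T}}, imprimitivity_system G [set: T] 'P Q].

Definition map_kernel (T : finType) (f : T -> T) : {set {set T}} :=
  [set f @^-1: [set y] | y in f @: [set: T]].

(* Integer partitions are represented by their nonincreasing list of parts. *)
Definition kernel_type (T : finType) (f : T -> T) : seq nat :=
  sort geq [seq #|B| | B : {set T} in map_kernel f].

Inductive generated_semigroup (T : Type) (A : (T -> T) -> Prop) :
    (T -> T) -> Prop :=
| gen_base h : A h -> generated_semigroup A h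
| gen_comp h1 h2 : generated_semigroup A h1 -> generated_semigroup A h2 ->
    generated_semigroup A (h1 \o h2).

Definition group_and_map (T : finType) (G : {group {perm T}}) (f : T -> T) :
    (T -> T) -> Prop :=
  fun h => (exists2 g : {perm T}, g \in G & h = g) \/ h = f.

Definition constant_map (T : Type) (h : T -> T) : Prop :=
  exists c, forall x, h x = c.

Definition synchronises (T : finType) (G : {group {perm T}}) (f : T -> T) :
    Prop :=
  exists2 h, generated_semigroup (group_and_map G f) h & constant_map h.

Lemma map_kernelE (T : finType) (f : T -> T) :
  map_kernel f = preim_partition f [set: T].
Proof.
rewrite /map_kernel /preim_partition /equivalence_partition -imset_comp.
by apply: eq_imset => x; apply/setP=> z; rewrite !inE eq_sym.
Qed.

Lemma acts_setactP (T : finType) (G : {group {perm T}}) (P : {set {set T}}) :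
  {in G, forall g : {perm T}, {in P, forall B : {set T}, g @: B \in P}} ->
  [acts G, on P | 'P^*].
Proof.
move=> GP; apply/subsetP=> g Gg; rewrite !inE; apply/subsetP=> B PB.
by rewrite inE; apply: GP.
Qed.

Lemma primitive_groupE (T : finType) (G : {group {perm T}}) :
  2 < #|T| -> primitive_group G = [primitive G, on [set: T] | 'P].
Proof.
move=> T_gt2; rewrite /primitive -/(primitive_group G).
case primG: (primitive_group G); last by rewrite andbF.
rewrite andbT; apply/esym; move/existsPn: primG => primG.
have actsT: [acts G, on [set: T] | 'P].
  by apply/actsP=> a _ x; rewrite !inE.
have partP := orbit_partition actsT; set P := _ @: _ in partP.
have actP: [acts G, on P | 'P^*].
  apply: acts_setactP => g Gg _ /imsetP[y _ ->].
  suff ->: g @: orbit 'P G y = orbit 'P G y by apply: imset_f; rewrite inE.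
  apply/eqP; rewrite eqEcard card_imset ?leqnn ?andbT; last exact: perm_inj.
  by apply/subsetP=> _ /imsetP[_ /orbitP[h Gh <-] ->]; apply/orbitP;
     exists (h * g); rewrite ?groupM // actM.
have [x _]: exists x : T, x \in T by apply/card_gt0P; apply: leq_trans T_gt2.
have := primG P; rewrite /imprimitivity_system partP actP /= negb_and -!leqNgt.
case/orP=> [P_le1 | P_geT].
  apply/imsetP; exists x => //; apply/esym.
  have Px: orbit 'P G x \in P by apply: imset_f.
  have /eqP P1: P == [set orbit 'P G x].
    by rewrite eq_sym eqEcard sub1set Px cards1.
  by have := cover_partition partP; rewrite P1 /cover big_set1.
have injP: injective (orbit 'P G).
  have: #|P| == #|[set: T]| by rewrite eqn_leq leq_imset_card.
  by move/imset_injP => injP y z; apply: injP; rewrite inE.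
have fixG g y: g \in G -> g y = y.
  by move=> Gg; apply: injP; apply/eqP; rewrite orbit_eq_mem;
     apply/orbitP; exists g.
pose Q := [set [set x]; ~: [set x]].
have cTx: #|~: [set x]| = #|T|.-1 by rewrite cardsC1.
have nQ: [set x] != ~: [set x].
  by apply/eqP=> /setP/(_ x); rewrite !inE eqxx.
suff: imprimitivity_system G [set: T] 'P Q by rewrite (negPf (primG Q)).
apply/and3P; split.
- apply/and3P; split.
  + by rewrite /cover /Q big_setU1 ?inE //= big_set1 setUCr.
  + apply/trivIsetP=> A B; rewrite !inE.
    case/orP=> /eqP-> /orP[]/eqP->; rewrite ?eqxx // => _.
      by rewrite -subsets_disjoint.
    by rewrite disjoint_sym -subsets_disjoint.
  + by rewrite !inE !(eq_sym set0) -!cards_eq0 cards1 cTx;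
       case: #|T| T_gt2 => [|[]].
- apply: acts_setactP => g Gg B QB; suff ->: g @: B = B by [].
  by rewrite (eq_imset _ (fun y => fixG g y Gg)) imset_id.
- by rewrite /Q cards2 nQ cardsT.
Qed.

(* Main.v *)
Require Import Defs.
From mathcomp Require Import all_boot all_fingroup all_solvable zify.

Set Implicit Arguments.
Unset Strict Implicit.
Unset Printing Implicit Defensive.

(* Suppose <G, f> contains no constant map, and join x to y when no element of
   <G, f> identifies them. This graph is G-invariant and f is an endomorphism
   of it. An element of <G, f> of minimal rank has a clique as image, and
   counting the translates of that clique shows that its rank divides n = #|T|;
   as the rank is neither 1 nor n, n is not prime.
   Let x, y lie in the kernel class of size p, mapped to a. The neighbourhoods
   N(x) and N(y) have d = #|N(a)| elements and both lie in the preimage of N(a),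
   which has at most d + 1 elements because only one other kernel class is
   nontrivial, and it has size 2. By primitivity N(x) and N(y) differ, hence
   #|N(x) \ N(y)| = 1. Let Y be the graph of all pairs with this property and e
   its valency. On average over w the edge cut of N(w) in Y has e edges, so by
   transitivity each does. A submodularity (uncrossing) argument shows that
   smallest nontrivial cuts with at most e edges would be blocks unless e = 2.
   So Y is a cycle preserved by the primitive group G, which forces n to be
   prime. *)

(** * Primitive groups: blocks, invariant equivalences, invariant cycles *)

Section PrimitiveGroup.

Local Open Scope group_scope.

Variables (T : finType) (G : {group {perm T}}).
Hypothesis primG : [primitive G, on [set: T] | 'P].

Lemma prim_transP x y : exists2 g : {perm T}, g \in G & g x = y.
Proof.
have [trG _] := andP primG.
by have [g Gg ->] := atransP2 trG (in_setT x) (in_setT y); exists g.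
Qed.

(** Point stabilisers of a primitive group are maximal; the second hypothesis puts the stabiliser of
    [x] inside [H]. *)
Lemma prim_maximal x (H : {group {perm T}}) :
    H \subset G -> {in G, forall g : {perm T}, g x = x -> g \in H} ->
  (forall g : {perm T}, g \in H -> g x = x) \/ H = G.
Proof.
move=> sHG Hx; have [trG _] := andP primG.
move: primG; rewrite (trans_prim_astab (in_setT x) trG) => /maximal_eqP[_].
case/(_ H) => // [|eqH|/group_inj ->]; [| |by right].
  apply/subsetP=> g /setIP[Gg /astab1P gx]; exact: Hx.
by left=> g; rewrite eqH => /setIP[_ /astab1P].
Qed.

(** The setwise stabiliser of [A] contains the stabiliser of a point of [A], so by maximality it is
    that stabiliser or [G]; transitivity then settles the size of [A]. *)
Lemma prim_block (A : {set T}) :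
    {in G, forall g : {perm T}, ~~ [disjoint g @: A & A] -> g @: A = A} ->
  #|A| <= 1 \/ A = setT.
Proof.
move=> blockA; case: (leqP #|A| 1) => [|A_gt1]; [by left | right].
have [x Ax]: exists x, x \in A by apply/card_gt0P; apply: ltnW.
have fixA (g : {perm T}) y : g \in G -> y \in A -> g y \in A -> g @: A = A.
  move=> Gg Ay Agy; apply: blockA => //; apply/pred0Pn; exists (g y).
  by rewrite /= imset_f.
have NA (g : {perm T}) : (g \in 'N_G(A | 'P)) = (g \in G) && (g @: A == A).
  by rewrite -astab1_set !inE sub1set inE.
have sNG : 'N_G(A | 'P)%G \subset G by apply: subsetIl.
case: (@prim_maximal x _ sNG) => [g Gg gx | fixx | eqG].
- by rewrite NA Gg (fixA _ x) ?gx //=.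
- have [y /setD1P[y_x Ay]]: exists y, y \in A :\ x.
    by apply/card_gt0P; move: A_gt1; rewrite (cardsD1 x) Ax.
  have [g Gg gxy] := prim_transP x y; case/eqP: y_x; rewrite -gxy.
  by apply: fixx; rewrite NA Gg (fixA _ x) ?gxy //=.
apply/setP=> y; rewrite inE; have [g Gg <-] := prim_transP x y.
have : g \in 'N_G(A | 'P)%G by rewrite eqG.
by rewrite NA => /andP[_ /eqP <-]; apply: imset_f.
Qed.

Lemma prim_nonblock (A : {set T}) :
    1 < #|A| < #|T| ->
  exists2 g : {perm T}, g \in G & g @: A :&: A != set0 /\ g @: A != A.
Proof.
case/andP=> A_gt1 A_ltT.
case: (boolP [exists g in G, (g @: A :&: A != set0) && (g @: A != A)]).
  by case/exists_inP=> g Gg /andP[]; exists g.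
move/exists_inPn=> blockA; case: (@prim_block A) => [g Gg | | A_T].
- by rewrite -setI_eq0 => gAA; move/(_ g Gg): blockA;
    rewrite gAA /= negbK => /eqP.
- by rewrite leqNgt A_gt1.
by move: A_ltT; rewrite A_T cardsT ltnn.
Qed.

(** Each class is a block, hence a singleton or everything; transitivity makes the alternative the
    same at all points. *)
Lemma prim_equiv (R : rel T) :
    equivalence_rel R ->
    {in G, forall (g : {perm T}) x y, R (g x) (g y) = R x y} ->
  (forall x y, R x y -> x = y) \/ (forall x y, R x y).
Proof.
move=> eqR RG.
have Rrefl x : R x x by case: (eqR x x x).
have Rl x y z : R x y -> R x z = R y z by case: (eqR x y z) => _; apply.
have cases x : (forall y, R x y -> x = y) \/ (forall y, R x y).
  case: (@prim_block [set y | R x y]) => [g Gg | A1 | AT].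
  - case/pred0Pn=> _ /andP[/imsetP[z + ->]]; rewrite !inE => xz xgz.
    have xgx : R x (g x) by rewrite (Rl _ _ _ xgz) -[R _ _](Rl (g x)) ?RG.
    apply/eqP; rewrite eqEcard card_imset ?leqnn ?andbT; last exact: perm_inj.
    apply/subsetP=> _ /imsetP[y + ->]; rewrite !inE => xy.
    by rewrite (Rl _ _ _ xgx) RG.
  - left=> y xy; move/card_le1_eqP: A1; apply; by rewrite inE.
  by right=> y; move/setP/(_ y): AT; rewrite !inE.
have transp x y : (forall z, R x z -> x = z) -> forall z, R y z -> y = z.
  move=> xP z yz; have [g Gg gyx] := prim_transP y x.
  by apply: (@perm_inj _ g); rewrite gyx; apply: xP; rewrite -gyx RG.
case: (boolP [forall x, forall y, R x y]) => [/forallP Rall|].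
  by right=> x y; apply/forallP.
case/forallPn=> x /forallPn[y nRxy]; left=> z t; apply: (transp x).
by case: (cases x) => // /(_ y); rewrite (negPf nRxy).
Qed.

(** A subgroup of prime order in [<[c]>] is characteristic there, hence normal in [G], hence
    transitive by primitivity, so [#|T|] divides that prime. *)
Lemma prim_normal_cyclic_prime (c : {perm T}) :
  1 < #|T| -> c != 1 -> <[c]> <| G -> prime #|T|.
Proof.
move=> T_gt1 c_neq1 nC; have c_gt1: 1 < #[c] by rewrite order_gt1.
have [z Cz oz] := Cauchy (pdiv_prime c_gt1) (pdiv_dvd _).
have pr_z : prime #[z] by rewrite oz pdiv_prime.
have nZ : <[z]> <| G.
  apply: char_normal_trans nC; rewrite sub_cyclic_char ?cycle_cyclic //.
  by rewrite cycle_subG.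
case: (prim_trans_norm primG nZ) => [|trZ].
  rewrite cycle_subG => /setIP[_ /astabP z1].
  have : z = 1 by apply/permP=> x; rewrite perm1; apply: z1.
  by move=> z_1; move: pr_z; rewrite z_1 order1.
have := atrans_dvd trZ; rewrite cardsT => T_z.
by rewrite (prime_nt_dvdP pr_z _ T_z) // -(ltn_predK T_gt1) neq_ltn; lia.
Qed.

(* An element of [G] fixing two adjacent points fixes everything, so point
   stabilisers have order at most 2 and [G] is cyclic or dihedral. *)
Lemma prim_valency2_prime (R : rel T) :
    1 < #|T| -> irreflexive R -> symmetric R ->
    {in G, forall (g : {perm T}) x y, R (g x) (g y) = R x y} ->
    (forall x, #|[set y | R x y]| = 2) ->
  prime #|T|.
Proof.
move=> T_gt1 Rirr Rsym RG R2.
(* The connected components form an invariant equivalence, and no point is isolated. *)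
have conn x y : connect R x y.
  have csym : connect_sym R by apply: sym_connect_sym.
  case: (@prim_equiv (connect R)) => [a b c|g Gg a b|disc|]; last exact.
  - by split=> [|ab]; [exact: connect0 | apply: same_connect].
  - have mono (h : {perm T}) u v : h \in G -> connect R u v ->
        connect R (h u) (h v).
      move=> Gh /connectP[s Rs ->{v}]; elim: s u Rs => //= v s IH u.
      case/andP=> uv /IH; apply: connect_trans; apply: connect1.
      by rewrite RG.
    apply/idP/idP; last exact: mono.
    by move/(mono g^-1); rewrite !permK groupV; apply.
  have [z]: exists z, z \in [set z | R x z] by apply/card_gt0P; rewrite R2.
  rewrite inE => xz; have xz' := disc _ _ (connect1 xz).
  by rewrite -xz' Rirr in xz.
have other x y z w : R x y -> R x z -> R x w -> z != y -> w != y -> z = w.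
  move=> xy xz xw z_y w_y.
  have /eqP/eq_leq/card_le1_eqP: #|[set z | R x z] :\ y| == 1%N.
    by have := R2 x; rewrite (cardsD1 y) inE xy add1n => -[->].
  by apply; rewrite !inE ?z_y ?w_y.
have fix2 (g : {perm T}) x y : g \in G -> R x y -> g x = x -> g y = y ->
    forall z, R x z -> g z = z.
  move=> Gg xy gx gy z xz; have [->//|z_y] := eqVneq z y.
  have xgz : R x (g z) by rewrite -{1}gx RG.
  by apply: (other x y) => //; rewrite -gy (inj_eq perm_inj).
have triv (g : {perm T}) x y : g \in G -> R x y -> g x = x -> g y = y -> g = 1.
  move=> Gg xy gx gy; apply/permP=> z; rewrite perm1.
  have /connectP[s] := conn x z.
  elim: s x y xy gx gy => [|w s IH] x y xy gx gy /=; first by move=> _ ->.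
  case/andP=> xw sw; apply: (IH w x) => //; first by rewrite Rsym.
  exact: (fix2 g x y).
have [x _] : exists x, x \in T by apply/card_gt0P; apply: ltnW.
have [y] : exists y, y \in [set y | R x y] by apply/card_gt0P; rewrite R2.
rewrite inE => xy.
have x_y : x != y by apply: contraTneq xy => ->; rewrite Rirr.
have gen_x (H : {group {perm T}}) (h : {perm T}) : H \subset G -> h \in H ->
    h x != x -> {in G, forall g : {perm T}, g x = x -> g \in H} -> H = G.
  move=> sHG Hh hx /(prim_maximal sHG)[fixx|//].
  by rewrite fixx ?eqxx in hx.
have [g Gg gxy] := prim_transP x y.
have g_neq1 : g != 1.
  by apply: contraNneq x_y => g1; rewrite -gxy g1 perm1.
(* If point stabilisers are trivial, they are maximal and [g] alone generates [G]. *)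
case: (boolP [exists s in G, (s x == x) && (s != 1)]); last first.
  move/exists_inPn=> stab1; apply: (prim_normal_cyclic_prime T_gt1 g_neq1).
  have defG : <[g]>%G = G.
    apply: (gen_x _ g); rewrite ?cycle_id ?cycle_subG ?gxy 1?eq_sym //.
    move=> h Gh hx; have := stab1 h Gh; rewrite hx eqxx /= negbK => /eqP->.
    exact: group1.
  by rewrite -defG; apply: normal_refl.
case/exists_inP=> s Gs /andP[/eqP sx s_neq1].
have stab (h : {perm T}) : h \in G -> h x = x -> h != 1 -> h = s.
  move=> Gh hx h_neq1.
  have syy : s y != y by apply: contraNneq s_neq1 => sy; rewrite (triv s x y).
  have hyy : h y != y by apply: contraNneq h_neq1 => hy; rewrite (triv h x y).
  have hsy : h y = s y.
    by apply: (other x y) => //; [rewrite -{1}hx RG | rewrite -{1}sx RG].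
  apply/eqP; rewrite eq_mulgV1; apply/eqP/(triv _ x y) => //.
  - by rewrite groupM ?groupV.
  - by rewrite permM hx -{1}sx permK.
  by rewrite permM hsy permK.
have ss : s * s = 1.
  apply/eqP; apply: contraNT s_neq1 => ss; have: s * s = s.
    by apply: stab; rewrite ?groupM // permM !sx.
  by move/(canRL (mulKg s)); rewrite mulVg => ->.
(* The involution [s] and its conjugate [t], which fixes [y], generate [G]; both invert [s * t], so
   [<[s * t]>] is normal. *)
pose t := s ^ g.
have tt : t * t = 1 by rewrite -conjMg ss conj1g.
have Gt : t \in G by rewrite groupJ.
have ty : t y = y by rewrite -gxy -permM -conjgC permM sx.
have t_neq1 : t != 1 by rewrite conjg_eq1.
have tx : t x != x by apply: contraNneq t_neq1 => tx; rewrite (triv t x y).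
have sV : s^-1 = s by apply/eqP; rewrite eq_invg_mul ss.
have tV : t^-1 = t by apply/eqP; rewrite eq_invg_mul tt.
have defG : (<<[set s; t]>>)%G = G.
  apply: (gen_x _ t); rewrite ?gen_subG ?subUset ?sub1set ?Gs ?Gt //.
    by rewrite mem_gen // !inE eqxx orbT.
  move=> h Gh hx; have [->|h_neq1] := eqVneq h 1; first exact: group1.
  by rewrite (stab h) // mem_gen // !inE eqxx.
clearbody t; apply: (prim_normal_cyclic_prime T_gt1 (c := s * t)).
  apply: contraNneq tx => st; suff ->: t = s by rewrite sx.
  by apply/eqP; rewrite -sV eq_sym eq_invg_mul st.
have inv (u : {perm T}) : u * u = 1 -> (s * t) ^ u = (s * t)^-1 ->
    u \in 'N(<[s * t]>).
  by move=> uu stu; rewrite inE -cycleJ stu cycleV.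
rewrite /normal cycle_subG groupM //= -{1}defG gen_subG subUset !sub1set.
by rewrite !inv // conjgE invMg sV tV !mulgA ?ss ?mul1g // -!mulgA tt mulg1.
Qed.

End PrimitiveGroup.

(** * Edge cuts of a graph and their uncrossing inequalities *)

Section EdgeCut.

Variables (T : finType) (R : rel T).

Definition edge_cut (A : {set T}) : nat :=
  \sum_x \sum_y [&& R x y, x \in A & y \notin A].

Lemma edge_cut_submodular A B :
  edge_cut (A :&: B) + edge_cut (A :|: B) <= edge_cut A + edge_cut B.
Proof.
rewrite /edge_cut -!big_split; apply: leq_sum => x _.
rewrite -!big_split; apply: leq_sum => y _; rewrite !inE.
by do 4!case: (_ \in _) => //=; case: (R x y).
Qed.

Lemma edge_cut_set1 x : irreflexive R -> edge_cut [set x] = #|[set y | R x y]|.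
Proof.
move=> Rirr; rewrite /edge_cut (bigD1 x) //= [X in _ + X]big1 ?addn0 => [|z zx].
  rewrite -sum1_card [RHS]big_mkcond /=; apply: eq_bigr => y _.
  by rewrite !inE eqxx /=; case: eqP => [->|]; rewrite ?Rirr ?andbT //;
    case: (R x y).
by rewrite big1 // => y _; rewrite inE (negPf zx) andbF.
Qed.

Hypothesis Rsym : symmetric R.

Lemma edge_cutC A : edge_cut (~: A) = edge_cut A.
Proof.
rewrite /edge_cut exchange_big; apply: eq_bigr => x _; apply: eq_bigr => y _.
by rewrite !inE negbK Rsym [(_ \notin _) && _]andbC.
Qed.

Lemma edge_cut_posimodular A B :
  edge_cut (A :\: B) + edge_cut (B :\: A) <= edge_cut A + edge_cut B.
Proof.
have := edge_cut_submodular A (~: B); rewrite edge_cutC -setDE.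
by rewrite -(edge_cutC (_ :|: _)) setCU setCK setIC -setDE.
Qed.

(** An edge between [x] and [y] lies in both singleton cuts but not in the cut of the pair. *)
Lemma edge_cut_set2 x y :
    irreflexive R -> x != y ->
  edge_cut [set x; y] + (R x y).*2 = edge_cut [set x] + edge_cut [set y].
Proof.
move=> Rirr x_y.
have pt a b : \sum_u \sum_v [&& R u v, u == a & v == b] = R a b :> nat.
  rewrite (bigD1 a) //= (bigD1 b) //= !eqxx !andbT !big1 ?addn0 // => u ua.
    by apply: big1 => v _; rewrite (negPf ua) andbF.
  by rewrite (negPf ua) !andbF.
rewrite -addnn -{1}pt (Rsym x y) -pt /edge_cut -!big_split;
  apply: eq_bigr => u _.
rewrite -!big_split; apply: eq_bigr => v _ /=; rewrite !inE.
have [->|ux] := eqVneq u x; have [->|vx] := eqVneq v x.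
- by rewrite Rirr.
- by rewrite (negPf x_y) !andbF /=; case: (R x v); case: (v == y).
- by rewrite (negPf x_y); case: (R u x); case: (u == y).
- by case: (eqVneq u y) => [->|]; case: (eqVneq v y) => [->|];
    rewrite ?Rirr ?andbF ?addn0.
Qed.

End EdgeCut.

(** * Small edge cuts in a graph with a primitive group *)

Section PrimitiveCut.

Variables (T : finType) (G : {group {perm T}}) (R : rel T) (e : nat).
Hypothesis primG : [primitive G, on [set: T] | 'P].
Hypothesis Rirr : irreflexive R.
Hypothesis Rsym : symmetric R.
Hypothesis RG : {in G, forall (g : {perm T}) x y, R (g x) (g y) = R x y}.
Hypothesis Re : forall x, #|[set y | R x y]| = e.

Lemma edge_cut_perm (g : {perm T}) (A : {set T}) :
  g \in G -> edge_cut R (g @: A) = edge_cut R A.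
Proof.
move=> Gg; rewrite /edge_cut (reindex_inj (@perm_inj _ g));
  apply: eq_bigr => x _.
rewrite (reindex_inj (@perm_inj _ g)); apply: eq_bigr => y _.
by rewrite RG // !mem_imset //; apply: perm_inj.
Qed.

(** [A] is not a block, so some translate meets it without being equal to it; two sets that meet and
    have at most half of the points each cannot cover [T]. *)
Lemma prim_crossing_translate (A : {set T}) :
    1 < #|A| -> #|A| <= #|~: A| ->
  exists B, [/\ edge_cut R B = edge_cut R A, #|B| = #|A|, A :&: B != set0,
                A :|: B != setT & A != B].
Proof.
move=> A_gt1 A_leC; have cA := cardsC A.
have [|g Gg [gAA gA_A]] := prim_nonblock primG (A := A); first by lia.
exists (g @: A); have cB : #|g @: A| = #|A| by rewrite card_imset //;
  apply: perm_inj.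
split=> //; [exact: edge_cut_perm | by rewrite setIC | | by rewrite eq_sym].
apply: contraTneq gAA => eqT; rewrite -cards_eq0 -lt0n -leqNgt.
have := cardsUI A (g @: A); rewrite eqT cardsT setIC cB; lia.
Qed.

(** Take a smallest set of minimum cut. Unless it is a point, it crosses a translate, and by
    submodularity the intersection is a smaller set of minimum cut. *)
Lemma prim_edge_connectivity (A : {set T}) : A != set0 -> A != setT -> e <=
  edge_cut R A.
Proof.
pose proper (B : {set T}) := (B != set0) && (B != setT).
have properC B : proper B -> proper (~: B).
  case/andP=> B0 BT; apply/andP; split.
    by rewrite -setCT (inj_eq (@setC_inj T)).
  by rewrite -setC0 (inj_eq (@setC_inj T)).
move=> A0 AT; have pA : proper A by rewrite /proper A0.
case: (arg_minnP (edge_cut R) pA) => M pM minM.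
pose min B := proper B && (edge_cut R B == edge_cut R M).
have mM : min M by rewrite /min pM eqxx.
case: (arg_minnP (fun B : {set T} => #|B|) mM) => B /andP[pB /eqP cB] minB.
apply: leq_trans (minM A pA); rewrite -cB.
have [B0 BT] := andP pB; have B_gt0 : 0 < #|B| by rewrite card_gt0.
have [B_le1 | B_gt1] := leqP #|B| 1.
  have /cards1P[x ->] : #|B| == 1%N by rewrite eqn_leq B_le1.
  by rewrite edge_cut_set1 // Re.
(* The complement has the same cut, so it is no smaller than [B]. *)
have B_leC : #|B| <= #|~: B|.
  by apply: minB; rewrite /min properC // edge_cutC // cB eqxx.
have [C [cC sC BC0 BCT neqBC]] := prim_crossing_translate B_gt1 B_leC.
have pI : proper (B :&: C).
  rewrite /proper BC0 /=; apply: contraNneq BT => eqT.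
  by rewrite -subTset -eqT subsetIl.
have pU : proper (B :|: C).
  rewrite /proper BCT andbT; apply: contraNneq B0 => eq0.
  by rewrite -subset0 -eq0 subsetUl.
have := edge_cut_submodular R B C; have := minM _ pI; have := minM _ pU.
rewrite cC cB => leU leI leUI.
have := minB (B :&: C); rewrite /min pI /= => minI.
have: B \subset C.
  have: B :&: C == B.
    rewrite eqEcard subsetIl /=; apply: minI; lia.
  by move/eqP/setIidPl.
by move=> sBC; case/eqP: neqBC; apply/eqP; rewrite eqEcard sBC sC leqnn.
Qed.

(** A smallest set [A] with at least two points inside and outside and cut at most [e] crosses a
    translate [B]. Uncrossing makes [A :&: B] and [A :\: B] singletons, so [A] is a pair, whose cut
    is [2e] or [2e - 2]. *)
Lemma prim_cut_valency (W : {set T}) :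
    0 < e -> 1 < #|W| -> 1 < #|~: W| -> edge_cut R W <= e ->
  e = 2.
Proof.
move=> e_gt0 W_gt1 WC_gt1 cW.
pose tight (B : {set T}) := [&& 1 < #|B|, 1 < #|~: B| & edge_cut R B <= e].
have tW : tight W by rewrite /tight W_gt1 WC_gt1.
case: (arg_minnP (fun B : {set T} => #|B|) tW) => A /and3P[A_gt1 AC_gt1 cA]
  minA.
have A_leC : #|A| <= #|~: A|.
  by apply: minA; rewrite /tight AC_gt1 setCK A_gt1 edge_cutC.
have [B [cB sB AB0 ABT neqAB]] := prim_crossing_translate A_gt1 A_leC.
have nsAB : ~~ (A \subset B).
  by apply: contra neqAB => sAB; rewrite eqEcard sAB sB leqnn.
have nsBA : ~~ (B \subset A).
  by apply: contra neqAB => sBA; rewrite eq_sym eqEcard sBA sB leqnn.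
(* The complement of [C] is larger than that of [A], so a second point in [C] would contradict the
   minimality of [A]. *)
have small (C : {set T}) : C \proper A -> C != set0 -> edge_cut R C <= e ->
  #|C| = 1%N.
  move=> /proper_card ltCA; rewrite -card_gt0 => C_gt0 cC.
  apply/eqP; rewrite eqn_leq C_gt0 andbT leqNgt; apply/negP=> C_gt1.
  have := minA C; rewrite /tight C_gt1 cC andbT => minC.
  have := cardsC C; have := cardsC A; lia.
have neT (C : {set T}) : C \proper A -> C != setT.
  by move=> /proper_card; apply: contraTneq => ->;
    rewrite cardsT -leqNgt max_card.
have pI : A :&: B \proper A by rewrite properEneq subsetIl andbT;
  apply/eqP=> /setIidPl; apply/negP.
have AB_ne0 : A :\: B != set0 by rewrite setD_eq0.
have BA_ne0 : B :\: A != set0 by rewrite setD_eq0.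
have pD : A :\: B \proper A.
  by rewrite properEneq subsetDl andbT; apply: contraNneq AB0 => /setDidPl;
    rewrite -setI_eq0.
have BA_neT : B :\: A != setT.
  apply: contraNneq AB0 => /setP eqT; apply/eqP/setP=> z.
  by have := eqT z; rewrite !inE; case: (z \in A).
have U_ne0 : A :|: B != set0.
  by apply: contraNneq AB0 => eq0; rewrite -subset0 -eq0 subIset // subsetUl.
have lI := prim_edge_connectivity AB0 (neT _ pI).
have lU := prim_edge_connectivity U_ne0 ABT.
have lD := prim_edge_connectivity AB_ne0 (neT _ pD).
have lD' := prim_edge_connectivity BA_ne0 BA_neT.
(* The right-hand sum is at most [2e], so one cut of at least [e] leaves at most [e] for the
   other. *)
have half_le a b : e <= b -> a + b <= edge_cut R A + edge_cut R B -> a <= e.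
  move=> e_b ab; rewrite -(leq_add2r e) (leq_trans (leq_add (leqnn a) e_b)) //.
  by rewrite (leq_trans ab) // cB leq_add.
have I1 : #|A :&: B| = 1%N.
  by apply: small => //; apply: half_le lU (edge_cut_submodular R A B).
have D1 : #|A :\: B| = 1%N.
  by apply: small => //; apply: half_le lD' (edge_cut_posimodular Rsym A B).
have le_e : e <= edge_cut R A.
  apply: prim_edge_connectivity; first by rewrite -card_gt0 ltnW.
  by rewrite -setC0 -(setCK A) (inj_eq (@setC_inj T)) -card_gt0 ltnW.
have /eqP/cards2P[x [y [x_y defA]]] : #|A| = 2 by rewrite -(cardsID B A) I1 D1.
have := edge_cut_set2 Rsym Rirr x_y; rewrite -defA !edge_cut_set1 // !Re.
move: (edge_cut R A) cA le_e e_gt0; clear => c.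
by case: (R x y) => /=; lia.
Qed.

End PrimitiveCut.

(** * Neighbourhoods that differ by one element *)

Section AlmostTwins.

Variables (T : finType) (G : {group {perm T}}) (X : rel T).
Hypothesis primG : [primitive G, on [set: T] | 'P].
Hypothesis Xirr : irreflexive X.
Hypothesis Xsym : symmetric X.
Hypothesis XG : {in G, forall (g : {perm T}) x y, X (g x) (g y) = X x y}.

Let N x := [set y | X x y].

Let N_perm (g : {perm T}) x : g \in G -> N (g x) = g @: N x.
Proof.
move=> Gg; apply/setP=> y; rewrite -[y](permKV g) mem_imset;
  last exact: perm_inj.
by rewrite !inE XG.
Qed.

Lemma prim_card_nbr x y : #|N x| = #|N y|.
Proof.
have [g Gg <-] := prim_transP primG x y.
by rewrite N_perm // card_imset //; apply: perm_inj.
Qed.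

(** Equality of neighbourhoods is an invariant equivalence, and the edge from [a] to [b] shows that
    it is not universal. *)
Lemma prim_twin_free a b x y : X a b -> N x = N y -> x = y.
Proof.
move=> ab; case: (prim_equiv primG (R := fun x y => N x == N y)).
- by move=> u v w; split=> // /eqP->.
- move=> g Gg u v; rewrite !N_perm //; apply/eqP/eqP=> [|-> //].
  by apply: imset_inj; apply: perm_inj.
- by move=> disc /eqP; apply: disc.
by move/(_ a b)/eqP/setP/(_ b); rewrite !inE ab Xirr.
Qed.

(* Joining [z] to [t] when [N z] and [N t] differ by one element, each edge lies
   in the cut of exactly one [N w]: the cuts [N w] average to the valency. *)
Lemma prim_almost_twins_prime x y :
    2 < #|T| -> (exists a b, X a b) -> x != y -> ~~ X x y ->
    #|N x :|: N y| <= #|N x|.+1 ->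
  prime #|T|.
Proof.
move=> T_gt2 [a [b ab]] x_y nXxy NU.
pose Y z t := #|N z :\: N t| == 1%N.
have Yirr : irreflexive Y by move=> z; rewrite /Y setDv cards0.
have Ysym : symmetric Y.
  move=> z t; rewrite /Y !cardsD (prim_card_nbr z t) setIC; congr (_ == _).
have YG : {in G, forall (g : {perm T}) z t, Y (g z) (g t) = Y z t}.
  move=> g Gg z t;
    rewrite /Y !N_perm // -(card_imset (N z :\: N t) (@perm_inj _ g)).
  congr (#|pred_of_set _| == _); apply/setP=> u; rewrite -[u](permKV g).
  by rewrite !inE !(mem_imset _ _ (@perm_inj _ g)) !inE.
pose e := #|[set t | Y x t]|.
have Ye z : #|[set t | Y z t]| = e.
  have [g Gg <-] := prim_transP primG x z.
  rewrite /e -(card_imset [set t | Y x t] (@perm_inj _ g)).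
  congr #|pred_of_set _|; apply/setP=> t; rewrite -[t](permKV g).
  by rewrite (mem_imset _ _ (@perm_inj _ g)) !inE YG.
(* [y] is a [Y]-neighbour of [x]: the bound on the union leaves at most one element in
   [N x :\: N y], and twin-freeness at least one. *)
have e_gt0 : 0 < e.
  apply/card_gt0P; exists y; rewrite inE /Y eqn_leq; apply/andP; split.
    have := cardsID (N y) (N x :|: N y);
      rewrite setIUl setIid setDUl setDv setU0.
    by rewrite (setUidPr (subsetIr _ _)) -(prim_card_nbr x y); lia.
  rewrite card_gt0 setD_eq0; apply: contra x_y => sN.
  by apply/eqP/(prim_twin_free ab)/eqP;
    rewrite eqEcard sN (prim_card_nbr y x) leqnn.
have cutN w : edge_cut Y (N w) = e.
  have cut_const u : edge_cut Y (N u) = edge_cut Y (N w).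
    have [g Gg <-] := prim_transP primG w u.
    by rewrite N_perm // (edge_cut_perm YG).
  apply/eqP; rewrite -(eqn_pmul2l (ltnW (ltnW T_gt2))); apply/eqP.
  transitivity (\sum_u edge_cut Y (N u)).
    by rewrite (eq_bigr (fun=> edge_cut Y (N w))) // sum_nat_const.
  transitivity (\sum_z \sum_t (Y z t : nat)).
    rewrite exchange_big; apply: eq_bigr => z _.
    rewrite exchange_big; apply: eq_bigr => t _.
    case Yzt: (Y z t); last by rewrite big1.
    transitivity #|N z :\: N t|; last exact/eqP.
    rewrite -sum1_card [RHS]big_mkcond; apply: eq_bigr => u _.
    by rewrite !inE (Xsym z) (Xsym t); case: (X u z); case: (X u t).
  rewrite (eq_bigr (fun=> e)) ?sum_nat_const // => z _.
  by rewrite -(Ye z) -sum1_card [RHS]big_mkcond; apply: eq_bigr => t _;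
    rewrite inE.
(* With valency at most 1, being equal or adjacent would be an invariant equivalence, nontrivial
   because of [a], [b] and not universal because of [x], [y]. *)
have N_gt1 : 1 < #|N x|.
  rewrite ltnNge; apply/negP=> N_le1.
  have N1 z u v : X z u -> X z v -> u = v.
    move=> zu zv; have /card_le1_eqP: #|N z| <= 1 by rewrite (prim_card_nbr z
      x).
    by apply; rewrite inE.
  case: (prim_equiv primG (R := fun u v => (u == v) || X u v)).
  - move=> u v w; rewrite eqxx; split=> // /orP[/eqP->//|uv].
    apply/orP/orP=> [][/eqP <-|uw]; [| left | by right | left].
    + by right; rewrite Xsym.
    + exact/eqP/(N1 u).
    + by apply/eqP/(N1 v) => //; rewrite Xsym.
  - by move=> g Gg u v; rewrite XG // (inj_eq perm_inj).
  - move=> disc; have E := disc a b; rewrite ab orbT in E.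
    by move: ab; rewrite E // Xirr.
  by move/(_ x y); rewrite (negPf x_y) (negPf nXxy).
have NC_gt1 : 1 < #|~: N x|.
  apply: leq_trans (subset_leq_card (_ : [set x; y] \subset _)).
    by rewrite cards2 x_y.
  by rewrite subUset !sub1set !inE Xirr nXxy.
have e2 : e = 2.
  apply: (prim_cut_valency primG Yirr Ysym YG Ye e_gt0 N_gt1 NC_gt1).
  by rewrite cutN.
apply: (prim_valency2_prime primG (ltnW T_gt2) Yirr Ysym YG) => z.
by rewrite Ye.
Qed.

End AlmostTwins.

(** * Pairs identified by the semigroup, and maps of minimal rank *)

Section Collapse.

Local Open Scope group_scope.

Variables (T : finType) (G : {group {perm T}}) (f : T -> T).

Notation S := (generated_semigroup (group_and_map G f)).

(** Reachability in this finite digraph of pairs turns collapsibility, an existence statement over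
    the inductive semigroup, into a boolean. *)
Definition collapse_step (u v : T * T) : bool :=
  (v == (f u.1, f u.2)) || [exists g in G, v == (g u.1, g u.2)].

Definition collapsible x y : bool :=
  [exists z, connect collapse_step (x, y) (z, z)].

Lemma semigroup_perm (g : {perm T}) : g \in G -> S g.
Proof. by move=> Gg; apply: gen_base; left; exists g. Qed.

Lemma semigroup_map : S f.
Proof. by apply: gen_base; right. Qed.

Lemma connect_collapse_step h x y :
  S h -> connect collapse_step (x, y) (h x, h y).
Proof.
move=> Sh; elim: h / Sh x y => [h [[g Gg ->]|->]|h1 h2 _ IH1 _ IH2] x y.
- by apply/connect1/orP; right; apply/exists_inP; exists g.
- by apply/connect1/orP; left.
exact: connect_trans (IH2 x y) (IH1 _ _).
Qed.

Lemma collapsibleP x y : reflect (exists2 h, S h & h x = h y) (collapsible x y).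
Proof.
apply: (iffP existsP) => [[z] | [h Sh hxy]]; last first.
  by exists (h x); rewrite {2}hxy; apply: connect_collapse_step.
case/connectP=> s; elim: s x y => [|[x' y'] s IH] x y /=.
  by move=> _ [-> ->]; exists (1 : {perm T}); first exact/semigroup_perm/group1.
case/andP=> step /IH{}IH /IH[h Sh hxy].
case/orP: step => [/eqP[ex ey]|/exists_inP[g Gg /eqP[ex ey]]].
  exists (h \o f); first exact: gen_comp semigroup_map.
  by rewrite /= -ex -ey.
exists (h \o g); first exact: gen_comp (semigroup_perm Gg).
by rewrite /= -ex -ey.
Qed.

Lemma collapsiblexx x : collapsible x x.
Proof. by apply/existsP; exists x; apply: connect0. Qed.

Lemma collapsible_sym : symmetric collapsible.
Proof.
by move=> x y; apply/collapsibleP/collapsibleP=> [][h Sh hxy]; exists h.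
Qed.

Lemma collapsible_map h x y : S h -> collapsible (h x) (h y) -> collapsible x y.
Proof.
move=> Sh /collapsibleP[k Sk kxy]; apply/collapsibleP; exists (k \o h) => //.
exact: gen_comp.
Qed.

Lemma collapsible_perm (g : {perm T}) x y :
  g \in G -> collapsible (g x) (g y) = collapsible x y.
Proof.
move=> Gg; apply/idP/idP; first exact: collapsible_map (semigroup_perm Gg).
rewrite -{1}(permK g x) -{1}(permK g y).
by apply: collapsible_map; apply: semigroup_perm; rewrite groupV.
Qed.

(** Descent on the rank: while two image points can be identified, composing with a map that does so
    shrinks the image. *)
Lemma exists_clique_image h0 :
    S h0 ->
  exists2 h, S h & #|h @: setT| <= #|h0 @: setT| /\
    forall x y, collapsible (h x) (h y) -> h x = h y.
Proof.
have [n] := ubnP #|h0 @: setT|; elim: n h0 => // n IH h le_n Sh.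
case: (boolP [forall x, forall y, collapsible (h x) (h y) ==> (h x == h y)]).
  move/forallP=> cl; exists h => //; split=> // x y.
  by move/forallP: (cl x) => /(_ y)/implyP col /col/eqP.
case/forallPn=> x /forallPn[y];
  rewrite negb_imply => /andP[/collapsibleP[k Sk kxy] nxy].
have Im : (k \o h) @: setT = k @: (h @: setT) by rewrite -imset_comp.
have lt_k : #|(k \o h) @: setT| < #|h @: setT|.
  rewrite Im ltn_neqAle leq_imset_card andbT;
    apply: contra nxy => /imset_injP inj.
  by apply/eqP/inj; rewrite ?imset_f.
have [|h' Sh' [le' cl]] := IH _ (leq_trans lt_k le_n); first exact: gen_comp.
by exists h' => //; split=> //; apply: leq_trans le' (ltnW lt_k).
Qed.

Hypothesis primG : [primitive G, on [set: T] | 'P].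

(* Every translate of the image of [h] is a clique of non-collapsible pairs, so
   it meets each fibre of [h] exactly once; now average over [G]. *)
Lemma clique_image_card_dvd h :
    S h -> (forall x y, collapsible (h x) (h y) -> h x = h y) ->
  #|h @: setT| %| #|T|.
Proof.
move=> Sh cl; set C := h @: setT.
case: (posnP #|T|) => [-> | /card_gt0P[x0 _]]; first exact: dvdn0.
pose B := h @^-1: [set h x0].
(* [K c] counts the group elements moving [c] into one fibre. It does not depend on [c], so its sums
   over [C] and over [T] compare their sizes. *)
pose K c := #|[set g in G | (g : {perm T}) c \in B]|.
have card_setE (I : finType) (A : {pred I}) (P : pred I) :
    #|[set c in A | P c]| = \sum_(c in A) (P c : nat).
  rewrite -sum1_card (eq_bigl (fun c => (c \in A) && P c)) => [|c].
    by rewrite big_mkcondr; apply: eq_bigr => c _; case: (P c).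
  by rewrite !inE.
have sumE (A : {set T}) : \sum_(c in A) K c =
    \sum_(g in G) #|[set c in A | (g : {perm T}) c \in B]|.
  rewrite (eq_bigr _ (fun c _ => card_setE _ G (fun g : {perm T} => g c \in
    B))).
  by rewrite exchange_big; apply: eq_bigr => g _; rewrite card_setE.
have Kconst c : K c = K x0.
  have [g Gg <-] := prim_transP primG x0 c.
  rewrite /K -(card_imset _ (mulgI g)); congr #|pred_of_set _|.
  apply/setP=> k; rewrite -[k](mulKVg g) (mem_imset _ _ (mulgI g)) !inE permM.
  by rewrite (groupMl _ Gg) permK mulKVg.
have KC : (#|C| * K x0 = #|G|)%N.
  rewrite -sum_nat_const -(eq_bigr _ (fun c _ => Kconst c)) sumE -sum1_card.
  apply: eq_bigr => g Gg; apply/eqP; apply/cards1P.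
  have injC : {in C &, injective (h \o g)}.
    move=> _ _ /imsetP[a _ ->] /imsetP[b _ ->] /= hab; apply: cl.
    rewrite -(collapsible_perm _ _ Gg); apply/collapsibleP; by exists h.
  have imC : (h \o g) @: C = C.
    apply/eqP; rewrite eqEcard (card_in_imset injC) leqnn andbT.
    by apply/subsetP=> _ /imsetP[c _ ->]; apply: imset_f.
  have: h x0 \in (h \o g) @: C by rewrite imC imset_f.
  case/imsetP=> c Cc hc; exists c; apply/setP=> b; rewrite !inE.
  apply/andP/eqP=> [[Cb /eqP hb]|->]; last by rewrite Cc hc /=.
  by apply: injC => //; rewrite /= hb.
have KT : (#|T| * K x0 = #|G| * #|B|)%N.
  rewrite -[#|T|]cardsT -sum_nat_const -(eq_bigr _ (fun c _ => Kconst c)) sumE.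
  rewrite -sum_nat_const; apply: eq_bigr => g Gg.
  rewrite -[RHS](card_imset _ (@perm_inj _ g^-1)); congr #|pred_of_set _|.
  apply/setP=> c; rewrite -{2}[c](permK g) (mem_imset _ _ (@perm_inj _ g^-1)).
  by rewrite !inE.
have K_gt0 : 0 < K x0 by have := cardG_gt0 G; rewrite -KC muln_gt0 => /andP[].
apply/dvdnP; exists #|B|; apply/eqP; rewrite -(eqn_pmul2r K_gt0) KT -KC.
by apply/eqP; lia.
Qed.

End Collapse.

(** * Counting with the kernel type *)

Lemma kernel_typeP (T : finType) (f : T -> T) (p k : nat) :
    kernel_type f = [:: p, 2 & nseq k 1%N] ->
  [/\ #|T| = (p + k).+2, #|f @: setT| = k.+2
    & exists a, #|f @^-1: [set a]| = p].
Proof.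
move=> f_type; have szE : size (kernel_type f) = k.+2 by rewrite f_type /=
  size_nseq.
have sumE : sumn (kernel_type f) = (p + k).+2.
  by rewrite f_type /= sumn_nseq mul1n; lia.
(* Distinct image points have distinct fibres, so the number of parts is the rank. *)
have inj : {in f @: setT &, injective (fun y => f @^-1: [set y])}.
  move=> _ b /imsetP[x _ ->] _ /setP/(_ x); rewrite !inE eqxx.
  by move=> /esym/eqP.
split.
- rewrite -sumE /kernel_type (perm_sumn (permEl (perm_sort _ _))).
  rewrite sumnE big_map big_enum map_kernelE /= -cardsT.
  exact: card_partition (preim_partitionP f setT).
- by move: szE; rewrite size_sort size_map -cardE (card_in_imset inj).
have: p \in kernel_type f by rewrite f_type inE eqxx.
rewrite mem_sort => /mapP[B]; rewrite mem_enum => /imsetP[a _ ->] ->.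
by exists a.
Qed.

(* Fibres over [f @: setT] outside [S] and [a] are nonempty, which bounds what is
   left for the preimage of [S]. *)
Lemma card_preim_le (T : finType) (f : T -> T) (p k : nat) a (S : {set T}) :
    #|T| = (p + k).+2 -> #|f @: setT| = k.+2 -> #|f @^-1: [set a]| = p ->
  0 < p -> a \notin S -> #|f @^-1: S| <= #|S|.+1.
Proof.
move=> cT cI cA p_gt0 aS; pose Q := f @: setT :\: (a |: S).
have Ia : a \in f @: setT.
  have /card_gt0P[x]: 0 < #|f @^-1: [set a]| by rewrite cA.
  by rewrite !inE => /eqP <-; apply: imset_f.
have leQ : #|Q| <= #|f @^-1: Q|.
  have sQ : Q \subset f @: (f @^-1: Q).
    apply/subsetP=> y Qy; have /setDP[/imsetP[x _ yx] _] := Qy.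
    by rewrite yx imset_f // inE -yx.
  exact: leq_trans (subset_leq_card sQ) (leq_imset_card _ _).
have geQ : #|f @: setT| <= #|Q| + #|S|.+1.
  rewrite -(cardsID (a |: S) (f @: setT)) addnC leq_add2l.
  apply: leq_trans (subset_leq_card (subsetIr _ _)) _.
  by rewrite cardsU1 aS.
have: #|f @^-1: [set a]| + #|f @^-1: S| + #|f @^-1: Q| <= #|T|.
  have dS : f @^-1: [set a] :&: f @^-1: S = set0.
    by apply/setP=> x; rewrite !inE; case: eqP => [->|_] //; apply: negPf.
  have dQ : (f @^-1: [set a] :|: f @^-1: S) :&: f @^-1: Q = set0.
    by apply/setP=> x; rewrite !inE; case: (_ || _).
  by rewrite -cardsUI dS cards0 addn0 -cardsUI dQ cards0 addn0 max_card.
move: leQ geQ; rewrite cT cI cA; lia.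
Qed.

Theorem theorem4p3 (T : finType) (G : {group {perm T}}) (f : T -> T)
    (p k : nat) (primG : primitive_group G) (p_ge2 : 2 <= p)
    (f_type : kernel_type f = [:: p, 2 & nseq k 1]) :
  synchronises G f.
Proof.
have [cT cI [a cA]] := kernel_typeP f_type.
have T_gt2 : 2 < #|T| by rewrite cT; lia.
move: primG; rewrite primitive_groupE // => primG.
have [h Sh [le_h cl]] := exists_clique_image (semigroup_map G f).
have [h1|h_neq1] := eqVneq #|h @: setT| 1%N.
  exists h => //; have /eqP/cards1P[c hc] := h1.
  by exists c => x; apply/set1P; rewrite -hc imset_f.
(* The rank of [h] divides [#|T|], is not 1, and is at most the rank [k + 2] of [f], which is less
   than [#|T|]. *)
exfalso; suff prT : prime #|T|.
  have := clique_image_card_dvd primG Sh cl; move/(prime_nt_dvdP prT h_neq1).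
  by move: le_h; rewrite cI cT => + eqT; rewrite eqT; lia.
have [x [y [fx fy x_y]]] : exists x y, [/\ f x = a, f y = a & x != y].
  have /card_gt1P[x [y [+ + x_y]]] : 1 < #|f @^-1: [set a]| by rewrite cA.
  by rewrite !inE => /eqP fx /eqP fy; exists x, y.
pose X := [rel x y | ~~ collapsible G f x y].
have XG : {in G, forall (g : {perm T}) x y, X (g x) (g y) = X x y}.
  by move=> g Gg u v; rewrite /= collapsible_perm.
have Xirr : irreflexive X by move=> z; rewrite /= collapsiblexx.
have Xf u v : X u v -> X (f u) (f v).
  by apply: contra; apply: collapsible_map; apply: semigroup_map.
apply: (prim_almost_twins_prime primG Xirr _ XG T_gt2 _ x_y).
- by move=> u v; rewrite /= collapsible_sym.
- have h_gt1 : 1 < #|h @: setT|.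
    by rewrite ltn_neqAle eq_sym h_neq1 card_gt0; apply/set0Pn; exists (h x);
      rewrite imset_f.
  have /card_gt1P[_ [_ [/imsetP[u _ ->] /imsetP[v _ ->] huv]]] := h_gt1.
  by exists (h u), (h v); apply: contra huv => /cl/eqP.
- rewrite /= negbK; apply/collapsibleP; exists f; first exact: semigroup_map.
  by rewrite fx fy.
(* Both neighbourhoods lie in the preimage of the neighbourhood of [a]. *)
rewrite (prim_card_nbr primG XG x a);
  apply: leq_trans (card_preim_le (S := [set z | X a z]) cT cI cA _ _).
- apply: subset_leq_card; rewrite subUset -{1}fx -fy.
  by apply/andP; split; apply/subsetP=> z; rewrite !inE => /Xf; rewrite ?fx ?fy.
- by lia.
by rewrite !inE collapsiblexx.
Qed.
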